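(* Let $X$, $U$ be Banach spaces, let $\mathcal{U}$ be an input space as described in the context, let $A$ be the generator of a $C_0$-semigroup $(T(t))_{t\ge 0}$ on $X$, and let $F:X\times U\to X$ be an operator as described in the context. Assume that $F$ satisfies one of the following conditions: 1. There exists $B\in\mathcal{L}(U,X)$ such that $F(\xi,v)=Bv$ for all $\xi\in X$ and $v\in U$. 2. $F(\xi-\zeta,v)=F(\xi,v)-F(\zeta,v)$ for all $\xi,\zeta\in X$ and $v\in U$. Then semi-uniform ISS implies strong ISS for $\Sigma(A,F)$; that is, if $\Sigma(A,F)$ is semi-uniformly ISS, then it is strongly ISS.
   Context: $\mathcal{L}(U,X)$ denotes the bounded linear operators from $U$ to $X$. Comparison functions, with $\mathbb{R}_+=[0,\infty)$: $\mathcal{K}$ is the set of continuous strictly increasing $\mu:\mathbb{R}_+\to\mathbb{R}_+$ with $\mu(0)=0$; $\mathcal{K}_\infty$ is the set of unbounded $\mu\in\mathcal{K}$; $\mathcal{L}$ is the set of continuous strictly decreasing $\mu:\mathbb{R}_+\to\mathbb{R}_+$ with $\lim_{t\to\infty}\mu(t)=0$; $\mathcal{KL}$ is the set of continuous $\kappa:\mathbb{R}_+\times\mathbb{R}_+\to\mathbb{R}_+$ with $\kappa(\cdot,t)\in\mathcal{K}$ for all $t\ge0$ and $\kappa(r,\cdot)\in\mathcal{L}$ for all $r>0$. Setting. $X$ and $U$ are Banach spaces with norms $\|\cdot\|$ and $\|\cdot\|_U$. $\mathcal{U}$ is a normed vector space, with norm $\|\cdot\|_{\mathcal U}$, contained in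 the space $L^1_{\mathrm{loc}}(\mathbb{R}_+,U)$ of locally integrable functions, such that for all $u\in\mathcal{U}$ and $\tau\ge 0$ one has $u(\cdot+\tau)\in\mathcal{U}$ and $\|u(\cdot+\tau)\|_{\mathcal U}\le\|u\|_{\mathcal U}$. $A$ with domain $D(A)$ generates a $C_0$-semigroup $(T(t))_{t\ge0}$ on $X$; the graph norm is $\|x\|_A:=\|x\|+\|Ax\|$ for $x\in D(A)$. $F:X\times U\to X$ is such that for every $\tau>0$, $f\in C([0,\tau],X)$, $g\in\mathcal{U}$, the map $t\mapsto F(f(t),g(t))$ is integrable on $[0,\tau]$. The system $\Sigma(A,F)$ is $\dot x(t)=Ax(t)+F(x(t),u(t))$, $t\ge0$, $x(0)=x_0\in X$, with $u\in\mathcal{U}$. A mild solution on $\mathbb{R}_+$ is $x\in C(\mathbb{R}_+,X)$ with $x(t)=T(t)x_0+\int_0^tT(t-s)F(x(s),u(s))\,\mathrm{d}s$ for all $t\ge0$ (Bochner integral). Definitions. $\Sigma(A,F)$ is forward complete if for all $x_0\in X$ and $u\in\mathcal{U}$ there is a unique mild solution on $\mathbb{R}_+$, denoted $\phi(\cdot,x_0,u)$. $\Sigma(A,F)$ is uniformly globally stable (UGS) if it is forward complete and there exist $\gamma,\mu\in\mathcal{K}_\infty$ such that $\|\phi(t,x_0,u)\|\le\gamma(\|x_0\|)+\mu(\|u\|_{\mathcal U})$ for all $x_0\in X$, $u\in\mathcal{U}$, $t\ge0$. $\Sigma(A,F)$ is semi-uniformly input-to-state stable (semi-uniformly ISS)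 if it is UGS and there exist $\kappa\in\mathcal{KL}$ and $\mu\in\mathcal{K}_\infty$ such that $\|\phi(t,x_0,u)\|\le\kappa(\|x_0\|_A,t)+\mu(\|u\|_{\mathcal U})$ for all $x_0\in D(A)$, $u\in\mathcal{U}$, $t\ge0$. $\Sigma(A,F)$ is strongly input-to-state stable (strongly ISS) if it is forward complete and there exist $\gamma,\mu\in\mathcal{K}_\infty$ and $\kappa:X\times\mathbb{R}_+\to\mathbb{R}_+$ such that (i) $\kappa(x_0,\cdot)\in\mathcal{L}$ for all $x_0\in X$ with $x_0\ne0$; (ii) $\kappa(x_0,t)\le\gamma(\|x_0\|)$ for all $x_0\in X$, $t\ge0$; (iii) $\|\phi(t,x_0,u)\|\le\kappa(x_0,t)+\mu(\|u\|_{\mathcal U})$ for all $x_0\in X$, $u\in\mathcal{U}$, $t\ge0$. *)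

(* Defs.v *)
From HB Require Import structures.
From mathcomp Require Import all_boot all_order all_algebra.
From mathcomp Require Import all_classical all_reals all_analysis.

Set Implicit Arguments.
Unset Strict Implicit.
Unset Printing Implicit Defensive.

Import Order.TTheory GRing.Theory Num.Theory.
Import numFieldNormedType.Exports.

Local Open Scope classical_set_scope.
Local Open Scope ring_scope.

                                                                              
                                                                 

Record class_K {R : realType} (f : R -> R) : Prop := {
  class_K_ge0 : forall r, 0 <= r -> 0 <= f r ;
  class_K_continuous : {within `[0, +oo[, continuous f} ;
  class_K_increasing : forall r s, 0 <= r -> r < s -> f r < f s ;
  class_K_0 : f 0 = 0 }.

Definition class_Kinfty {R : realType} (f : R -> R) : Prop :=
  class_K f /\ (forall M : R, exists2 r, 0 <= r & M < f r).

Record class_L {R : realType} (f : R -> R) : Prop := {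
  class_L_ge0 : forall t, 0 <= t -> 0 <= f t ;
  class_L_continuous : {within `[0, +oo[, continuous f} ;
  class_L_decreasing : forall s t, 0 <= s -> s < t -> f t < f s ;
  class_L_cvg0 : f t @[t --> +oo] --> 0 }.

Record class_KL {R : realType} (k : R -> R -> R) : Prop := {
  class_KL_continuous :
    {within [set p : R * R | 0 <= p.1 /\ 0 <= p.2],
      continuous (fun p : R * R => k p.1 p.2)} ;
  class_KL_K : forall t, 0 <= t -> class_K (fun r => k r t) ;
  class_KL_L : forall r, 0 < r -> class_L (k r) }.

Definition bounded_linear {R : realType} {V W : normedModType R}
    (f : V -> W) : Prop :=
  linear f /\ exists M : R, forall v, `|f v| <= M * `|v|.

                                                       

Definition simple_integral {R : realType} {V : normedModType R} (a b : R)
    (s : R -> V) : V :=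
  \sum_(x \in range s)
    fine (lebesgue_measure (`[a, b] `&` s @^-1` [set x])) *: x.

                                                                           
                                                                         
                                                                                
                                                                        
                                                     
Definition is_bochner_integral {R : realType} {V : normedModType R} (a b : R)
    (f : R -> V) (v : V) : Prop :=
  exists s : nat -> {fimfun R >-> V},
  [/\ forall n x, measurable (s n @^-1` [set x]),
      {ae lebesgue_measure, forall t : R, t \in `[a, b] ->
        s n t @[n --> \oo] --> f t},
      (\int[lebesgue_measure]_(t in `[a, b]) `|f t - s n t|%:E)%E
        @[n --> \oo] --> 0%E &
      simple_integral a b (s n) @[n --> \oo] --> v].

Definition bochner_integrable {R : realType} {V : normedModType R} (a b : R)
    (f : R -> V) : Prop :=
  exists v : V, is_bochner_integral a b f v.

                                                                      
                                                                            
                                                     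
Record input_space {R : realType} {U : completeNormedModType R}
    {UU : normedModType R} (ev : UU -> R -> U) : Prop := {
  input_linear : forall (a : R) (u v : UU),
    {ae lebesgue_measure, forall t : R, 0 <= t ->
      ev (a *: u + v) t = a *: ev u t + ev v t} ;
  input_injective : forall u v : UU,
    {ae lebesgue_measure, forall t : R, 0 <= t -> ev u t = ev v t} -> u = v ;
  input_loc_integrable : forall (u : UU) (tau : R), 0 < tau ->
    bochner_integrable 0 tau (ev u) ;
  input_shift : forall (u : UU) (tau : R), 0 <= tau ->
    exists2 w : UU,
      {ae lebesgue_measure, forall t : R, 0 <= t -> ev w t = ev u (t + tau)} &
      `|w| <= `|u| }.

Record C0_semigroup {R : realType} {X : completeNormedModType R}
    (T : R -> X -> X) : Prop := {
  C0_bounded_linear : forall t, 0 <= t -> bounded_linear (T t) ;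
  C0_0 : forall x, T 0 x = x ;
  C0_add : forall s t x, 0 <= s -> 0 <= t -> T (s + t) x = T s (T t x) ;
  C0_strong_continuous : forall x, T t x @[t --> 0^'+] --> x }.

                                                 
Record generates {R : realType} {X : completeNormedModType R}
    (DA : set X) (A : X -> X) (T : R -> X -> X) : Prop := {
  generates_domain : forall x,
    DA x <-> exists y : X, h^-1 *: (T h x - x) @[h --> 0^'+] --> y ;
  generates_cvg : forall x, DA x ->
    h^-1 *: (T h x - x) @[h --> 0^'+] --> A x }.

Definition graph_norm {R : realType} {X : completeNormedModType R}
  (A : X -> X) (x : X) : R := `|x| + `|A x|.

Definition admissible_nonlinearity {R : realType}
    {X U : completeNormedModType R} {UU : normedModType R} (ev : UU -> R -> U)
    (F : X -> U -> X) : Prop :=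
  forall (tau : R) (f : R -> X) (g : UU), 0 < tau ->
    {within `[0, tau], continuous f} ->
    bochner_integrable 0 tau (fun t => F (f t) (ev g t)).

Section System.
Context {R : realType} {X U : completeNormedModType R} {UU : normedModType R}.
Variables (ev : UU -> R -> U) (DA : set X) (A : X -> X) (T : R -> X -> X).
Variable F : X -> U -> X.

Definition mild_solution (x0 : X) (u : UU) (x : R -> X) : Prop :=
  {within `[0, +oo[, continuous x} /\
  forall t, 0 <= t -> exists2 v : X,
    is_bochner_integral 0 t (fun s => T (t - s) (F (x s) (ev u s))) v &
    x t = T t x0 + v.

Definition forward_complete : Prop :=
  forall (x0 : X) (u : UU), exists2 x : R -> X, mild_solution x0 u x &
    forall y, mild_solution x0 u y -> forall t, 0 <= t -> y t = x t.

                                                                              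
                                                                  

Definition UGS : Prop :=
  forward_complete /\
  exists gamma mu : R -> R, [/\ class_Kinfty gamma, class_Kinfty mu &
    forall (x0 : X) (u : UU) (phi : R -> X), mild_solution x0 u phi ->
      forall t, 0 <= t -> `|phi t| <= gamma `|x0| + mu `|u|].

Definition semi_uniformly_ISS : Prop :=
  UGS /\
  exists (kappa : R -> R -> R) (mu : R -> R),
    [/\ class_KL kappa, class_Kinfty mu &
    forall (x0 : X) (u : UU) (phi : R -> X), DA x0 -> mild_solution x0 u phi ->
      forall t, 0 <= t -> `|phi t| <= kappa (graph_norm A x0) t + mu `|u|].

Definition strongly_ISS : Prop :=
  forward_complete /\
  exists (gamma mu : R -> R) (kappa : X -> R -> R),
    (class_Kinfty gamma /\ class_Kinfty mu) /\
    [/\ forall x0 t, 0 <= t -> 0 <= kappa x0 t,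
        forall x0, x0 != 0 -> class_L (kappa x0),
        forall x0 t, 0 <= t -> kappa x0 t <= gamma `|x0| &
        forall (x0 : X) (u : UU) (phi : R -> X), mild_solution x0 u phi ->
          forall t, 0 <= t -> `|phi t| <= kappa x0 t + mu `|u|].

End System.

(* Main.v *)
Require Import Defs.
From HB Require Import structures.
From mathcomp Require Import all_boot all_order all_algebra.
From mathcomp Require Import all_classical all_reals all_analysis.
From mathcomp Require Import measurable_realfun ring lra.

Set Implicit Arguments.
Unset Strict Implicit.
Unset Printing Implicit Defensive.

Import Order.TTheory GRing.Theory Num.Theory.
Import numFieldNormedType.Exports.
Local Open Scope classical_set_scope.
Local Open Scope ring_scope.

(**
Two solutions driven by the same input differ by a solution of the same
system: if F(xi,v) = Bv the forcing terms cancel and phi(t,x0,u) - phi(t,y0,u)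
solves the system with initial value x0 - y0 and input 0; if F is additive in
its first argument the difference solves it with initial value x0 - y0 and
input u ([mild_solution_difference]).  Uniform global stability bounds this
difference by gamma(|x0-y0|) + mu(|u|), and semi-uniform ISS bounds the solution
that starts at y0 in D(A), so that ([mild_solution_bound])

  |phi(t,x0,u)| <= kappa(|y0|_A, t) + gamma(|x0-y0|) + mu''(|u|)

for every y0 in D(A).  Since D(A) is dense ([generator_domain_dense]), y0 can be
taken so close to x0 that the gamma term is small, and then the kappa term
vanishes as t grows.  Hence |phi(t,x0,u)| - mu''(|u|) is dominated, uniformly in
u, by a quantity which is at most gamma(|x0|) and tends to 0.  The last step
turns this domination into a function of class L: the supremum of the family of
1-Lipschitz nonincreasing functions t |-> v - max(0, t-s), over all recorded
values v at times s, is continuous and nonincreasing, tends to 0 and dominates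
every v at its own time s ([decay_envelope]); adding gamma(|x0|) exp(-t) makes it
strictly decreasing.

Two ingredients need work.  The first is that Bochner integrals may be
subtracted.  Integrands are only almost everywhere limits of simple functions,
hence need not be Borel measurable, while additivity of the Lebesgue integral
requires measurability; the remedy is that the integral of a nonnegative
function, being a supremum over simple functions below it, does not see null
sets ([le_integral_off_null]), and off a null set the integrands are measurable
([measurable_norm_limit_sub]).

The second is the density of D(A).  In place of the vector-valued integral of
the orbit over [0,t], divided by t, the proof uses the limit P of the means of
T(kt/N)x, k < N, along N = 2^n.  By the Banach-Steinhaus theorem T is bounded near
0, so that refining the mesh changes the mean by at most a constant times the
oscillation of the orbit over one mesh interval ([orbit_avg_refine]); thus the means converge.  The
identity for geometric sums (a^m - 1)(1 + ... + a^(N-1)) = (a^N - 1)(1 + ... +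
a^(m-1)), read with a = T(t/N) ([orbit_sum_swap]), shows that T(h)P - P is close to
(h/t)(T(t)x - x) ([orbit_mean_increment]), whence P lies in D(A), and P is close
to x for small t.
*)

(** * Lebesgue integrals of functions that need not be measurable *)

Section NonMeasurableIntegral.
Local Open Scope ereal_scope.
Context d (T : measurableType d) (R : realType).
Variable mu : {measure set T -> \bar R}.
Import HBNNSimple.

(** A simple function below f stays below g once it is set to zero on N, and this
does not change its integral.  Hence the comparison holds for arbitrary, possibly
non-measurable, f and g. *)
Lemma le_integral_off_null (D N : set T) (f g : T -> \bar R) :
  measurable N -> mu N = 0 ->
  (forall x, D x -> 0 <= f x) -> (forall x, D x -> 0 <= g x) ->
  (forall x, D x -> ~ N x -> f x <= g x) ->
  \int[mu]_(x in D) f x <= \int[mu]_(x in D) g x.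
Proof.
move=> mN N0 f0 g0 fg; rewrite !ge0_integralE//.
apply: ge_ereal_sup => _ [h hf <-].
have mCN : measurable (~` N) by exact: measurableC.
have -> : sintegral mu h = sintegral mu (proj_nnsfun h mCN).
  rewrite -integralT_nnsfun (ge0_negligible_integral mN)//; last 2 first.
  - exact/measurable_EFinP.
  - by move=> x _; rewrite lee_fin; exact: fun_ge0.
  rewrite setTD integral_nnsfun//; apply: eq_sintegral => x.
  rewrite /= mindicE /patch; case: ifPn => xN; rewrite ?mulr1 ?mulr0//.
apply: ereal_sup_ubound; exists (proj_nnsfun h mCN) => // x /=.
rewrite mindicE /patch.
have [xN|xN] := boolP (x \in ~` N); last first.
  rewrite mulr0; case: ifPn => // xD; exact/g0/set_mem.
rewrite mulr1; have := hf x; rewrite /= /patch.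
case: ifPn => // xD /le_trans; apply.
by apply: fg; [exact: set_mem|have := set_mem xN].
Qed.

End NonMeasurableIntegral.

(** * Simple functions and Bochner integrals *)

Section SimpleFunctions.
Context {R : realType}.

Lemma measurable_fimfun_comp {d} {T : measurableType d} {W : choiceType} {Y : Type}
    (p : {fimfun T >-> W}) (psi : W -> Y) (B : set Y) :
  (forall w, measurable (p @^-1` [set w])) ->
  measurable ((psi \o p) @^-1` B).
Proof.
move=> mp.
have -> : (psi \o p) @^-1` B =
    \bigcup_(w in range p `&` psi @^-1` B) p @^-1` [set w].
  apply/seteqP; split => [t Bt|t [w [_ Bw] ptw]]; last first.
    by move: Bw; rewrite /preimage/= ptw.
  by exists (p t) => //; split => //; exists t.
apply: fin_bigcup_measurable => //.
exact: finite_setIl.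
Qed.

(** Change of variables: the integral of a simple function may be computed from
the level sets of any finer simple function p.  Applied to a pair of simple
functions it yields the additivity of the integral. *)
Lemma simple_integral_comp {V : normedModType R} {W : choiceType} (a b : R)
    (p : {fimfun R >-> W}) (psi : W -> V) :
  (forall w, measurable (p @^-1` [set w])) ->
  simple_integral a b (psi \o p) =
  \sum_(w \in range p)
    fine (lebesgue_measure (`[a, b] `&` p @^-1` [set w])) *: psi w.
Proof.
move=> mp; rewrite /simple_integral.
set m := fun A : set R => fine (lebesgue_measure (`[a, b] `&` A)).
have fr : finite_set (range (psi \o p)).
  rewrite (_ : range _ = psi @` range p); first exact: finite_image.
  by rewrite image_comp.
have mE z : m ((psi \o p) @^-1` [set z]) =
    \sum_(w \in range p) if psi w == z then m (p @^-1` [set w]) else 0.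
  rewrite {1}/m; have -> : `[a, b] `&` (psi \o p) @^-1` [set z] = 
    \bigcup_(w in range p `&` psi @^-1` [set z]) (`[a, b] `&` p @^-1` [set w]).
    apply/seteqP; split => [t [It zt]|t [w [_ Bw] [It ptw]]]; last first.
      by split => //; move: Bw; rewrite /preimage/= ptw.
    by exists (p t) => //; split => //; exists t.
  rewrite measure_fin_bigcup//=; last 3 first.
  - exact: finite_setIl.
  - by apply/trivIset_setIl => x y _ _ [t [px py]]; rewrite -px -py.
  - by move=> w _; apply: measurableI; [exact: measurable_itv|exact: mp].
  transitivity (\sum_(w \in range p `&` psi @^-1` [set z]) m (p @^-1` [set w])).
    have fI : finite_set (range p `&` psi @^-1` [set z]) by exact: finite_setIl.
    rewrite !fsbig_finite//=.
    have fin w : lebesgue_measure (`[a, b] `&` p @^-1` [set w]) \is a fin_num.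
      have lt : (lebesgue_measure (`[a, b] `&` p @^-1` [set w]) < +oo)%E.
        apply: (@le_lt_trans _ _ (lebesgue_measure `[a, b])).
          by apply: le_measure; rewrite ?inE//; apply: measurableI; [exact: measurable_itv|exact: mp].
        rewrite lebesgue_measure_itv/=; by case: ifP => _; rewrite ltry.
      by rewrite ge0_fin_numE.
    under eq_bigr => w _ do rewrite -(fineK (fin w)).
    by rewrite sumEFin.
  rewrite fsbig_mkcondr; apply: eq_fsbigr => w _.
  suff -> : (w \in psi @^-1` [set z]) = (psi w == z) by [].
  by apply/idP/eqP; rewrite inE.
transitivity (\sum_(z \in range (psi \o p)) \sum_(w \in range p)
    if psi w == z then m (p @^-1` [set w]) *: psi w else 0).
  apply: eq_fsbigr => z _; rewrite -/(m _) mE !fsbig_finite//= scaler_suml.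
  by apply: eq_bigr => w _; case: eqP => [->//|]; rewrite scale0r.
rewrite exchange_fsbig//; apply: eq_fsbigr => w /set_mem[t _ <-].
rewrite (fsbigD1 (psi (p t)))//=; last by exists t.
rewrite eqxx fsbig1 ?addr0// => z [_ /eqP]; rewrite eq_sym.
by move=> /negPf ->.
Qed.

End SimpleFunctions.

Lemma ae_lebesgue_filter (R : realType) :
  Filter (almost_everywhere (@lebesgue_measure R)).
Proof. exact: ae_filter_ringOfSetsType. Qed.

Section BochnerDifference.
Context {R : realType} {V : normedModType R}.
Implicit Types s : {fimfun R >-> V}.

Definition pair_fimfun s s' : R -> V * V := fun t => (s t, s' t).

Lemma finite_image_pair_fimfun s s' : finite_set (range (pair_fimfun s s')).
Proof. exact: (finite_image11 pair). Qed.

HB.instance Definition _ s s' :=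
  FiniteImage.Build R (V * V)%type (pair_fimfun s s')
    (finite_image_pair_fimfun s s').

Lemma measurable_pair_fimfun s s' :
  (forall x, measurable (s @^-1` [set x])) ->
  (forall x, measurable (s' @^-1` [set x])) ->
  forall w, measurable (pair_fimfun s s' @^-1` [set w]).
Proof.
move=> ms ms' [x y].
rewrite (_ : _ @^-1` _ = s @^-1` [set x] `&` s' @^-1` [set y]).
  exact: measurableI.
by apply/seteqP; split => t /=; rewrite /pair_fimfun => -[-> ->].
Qed.

Lemma simple_integral_sub a b s s' :
  (forall x, measurable (s @^-1` [set x])) ->
  (forall x, measurable (s' @^-1` [set x])) ->
  simple_integral a b (fun t => s t - s' t) =
  simple_integral a b s - simple_integral a b s'.
Proof.
move=> ms ms'; have mp := measurable_pair_fimfun ms ms'.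
have e1 := simple_integral_comp a b fst mp.
have e2 := simple_integral_comp a b snd mp.
have e3 := simple_integral_comp a b (fun w => w.1 - w.2) mp.
rewrite [X in simple_integral a b X](_ : _ = (fun w => w.1 - w.2) \o pair_fimfun s s')//.
rewrite e3.
rewrite [X in X - _](_ : _ = simple_integral a b (fst \o pair_fimfun s s'))//.
rewrite [X in _ - X](_ : _ = simple_integral a b (snd \o pair_fimfun s s'))//.
rewrite e1 e2 !fsbig_finite//= -sumrB.
by apply: eq_bigr => w _; rewrite scalerBr.
Qed.

(** Off a null set N outside which the approximating simple functions converge,
the error |f - s| is a pointwise limit of measurable functions; the factor that
vanishes on N removes the points where f is arbitrary. *)
Lemma measurable_norm_limit_sub (D N : set R) (s_ : nat -> {fimfun R >-> V})
    (s : {fimfun R >-> V}) (f : R -> V) :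
  measurable D -> measurable N ->
  (forall n x, measurable (s_ n @^-1` [set x])) ->
  (forall x, measurable (s @^-1` [set x])) ->
  (forall t, D t -> ~ N t -> s_ n t @[n --> \oo] --> f t) ->
  measurable_fun D (fun t => `|f t - s t| * \1_(~` N) t).
Proof.
move=> mD mN ms_ ms cvg_s.
apply: (@measurable_fun_cvg _ _ _ D
  (fun n t => `|s_ n t - s t| * \1_(~` N) t)) => [n|t Dt].
  apply: measurable_funM; last first.
    by apply: measurable_indic; exact: measurableC.
  apply: measurable_funS measurableT _ _ => // _ B mB; rewrite setTI.
  have := measurable_fimfun_comp (fun w => `|w.1 - w.2|) B
    (measurable_pair_fimfun (ms_ n) ms).
  exact.
have [Nt|Nt] := pselect (N t).
  rewrite indicE memNset; last exact: (fun H => H Nt).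
  rewrite mulr0; under eq_fun do rewrite mulr0; exact: cvg_cst.
apply: cvgM; last exact: cvg_cst.
by apply: cvg_norm; apply: cvgB; [exact: cvg_s|exact: cvg_cst].
Qed.

(** The approximants of f - g are the differences of approximants.  Both errors
are cut off outside the common null set N, where they become measurable and the
Lebesgue integral is additive.  Equality of h and f - g is required almost
everywhere only, because input functions are determined up to null sets. *)
Lemma is_bochner_integral_sub (a b : R) (f g h : R -> V) (v w : V) :
  is_bochner_integral a b f v -> is_bochner_integral a b g w ->
  {ae lebesgue_measure, forall t : R, t \in `[a, b] -> h t = f t - g t} ->
  is_bochner_integral a b h (v - w).
Proof.
move=> [s [ms sf If Sf]] [s' [ms' sg Ig Sg]] hfg.
exists (fun n => [the {fimfun R >-> V} of
  (fun x : V * V => x.1 - x.2) \o pair_fimfun (s n) (s' n)]).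
have [N [mN N0 subN]] : {ae lebesgue_measure,
    forall t : R, t \in `[a, b] ->
       [/\ s n t @[n --> \oo] --> f t, s' n t @[n --> \oo] --> g t &
        h t = f t - g t]}.
  by apply: (@filterS3 _ _ (ae_lebesgue_filter R) _ _ _ _ _ sf sg hfg) =>
    t sft sgt hfgt tab; split; auto.
have cvgN t : t \in `[a, b] -> ~ N t ->
    [/\ s n t @[n --> \oo] --> f t, s' n t @[n --> \oo] --> g t &
        h t = f t - g t].
  move=> tab Nt; apply: contrapT => H; apply/Nt/subN => /= H'; exact/H/H'.
split.
- move=> n x.
  have := measurable_fimfun_comp (fun x => x.1 - x.2) [set x]
    (measurable_pair_fimfun (ms n) (ms' n)).
  exact.
- exists N; split => //; apply: subset_trans subN.
  apply: subsetC => t /= H tab; have [ft gt ->] := H tab.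
  exact: cvgB.
- pose h1 n t : R := `|f t - s n t| * \1_(~` N) t.
  pose h2 n t : R := `|g t - s' n t| * \1_(~` N) t.
  pose D : set R := [set` `[a, b]].
  have mD : measurable D by exact: measurable_itv.
  have mh1 n : measurable_fun D (h1 n).
    by apply: (measurable_norm_limit_sub mD mN ms (ms n)) => // t Dt Nt; have [] := cvgN t Dt Nt.
  have mh2 n : measurable_fun D (h2 n).
    by apply: (measurable_norm_limit_sub mD mN ms' (ms' n)) => // t Dt Nt; have [] := cvgN t Dt Nt.
  have h10 n t : 0 <= h1 n t by rewrite mulr_ge0// indicE.
  have h20 n t : 0 <= h2 n t by rewrite mulr_ge0// indicE.
  apply: (@squeeze_cvge _ _ _ _ (fun=> 0%E) _
    (fun n => (\int[lebesgue_measure]_(t in `[a, b]) `|f t - s n t|%:E +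
      \int[lebesgue_measure]_(t in `[a, b]) `|g t - s' n t|%:E)%E)).
  + apply: nearW => n; apply/andP; split; first by apply: integral_ge0 => t _; rewrite lee_fin.
    apply: (@le_trans _ _ (\int[lebesgue_measure]_(t in D) ((h1 n t)%:E + (h2 n t)%:E))%E).
      apply: (le_integral_off_null mN N0).
      * by move=> t _; rewrite lee_fin.
      * by move=> t _; rewrite -EFinD lee_fin addr_ge0.
      move=> t Dt Nt; have [_ _ ->] := cvgN t Dt Nt.
      rewrite -EFinD lee_fin /h1 /h2 indicE mem_set//= !mulr1.
      rewrite (_ : _ - _ = (f t - s n t) - (g t - s' n t)) ?ler_normB//.
      by rewrite /pair_fimfun/= !opprB addrACA [RHS]addrACA [- g t + _]addrC [- s n t + _]addrC.
    have mh1' : measurable_fun D (fun t => (h1 n t)%:E) by exact/measurable_EFinP.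
    have mh2' : measurable_fun D (fun t => (h2 n t)%:E) by exact/measurable_EFinP.
    have h1' t : D t -> (0 <= (h1 n t)%:E)%E by rewrite lee_fin.
    have h2' t : D t -> (0 <= (h2 n t)%:E)%E by rewrite lee_fin.
    rewrite (ge0_integralD lebesgue_measure mD h1' mh1' h2' mh2').
    have le1 (x : R) (t : R) : 0 <= x -> x * \1_(~` N) t <= x.
      by move=> x0; rewrite indicE; case: (_ \in _); rewrite ?mulr1 ?mulr0.
    apply: leeD; apply: (le_integral_off_null mN N0) => t Dt *;
      by rewrite lee_fin// le1.
  + exact: cvg_cst.
  + rewrite -[X in _ --> X]adde0; exact: cvgeD.
- have -> : (fun n => simple_integral a b
      ((fun x : V * V => x.1 - x.2) \o pair_fimfun (s n) (s' n))) =
    (fun n => simple_integral a b (s n) - simple_integral a b (s' n)).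
    by apply/funext => n; rewrite -simple_integral_sub.
  exact: cvgB.
Qed.

End BochnerDifference.

(** * Local boundedness of strongly continuous semigroups *)

Section SemigroupBounded.
Context {R : realType} {X : completeNormedModType R}.
Variable T : R -> X -> X.
Hypothesis hT : C0_semigroup T.

Lemma C0_linear t : 0 <= t -> linear (T t).
Proof. by move=> t0; have [] := C0_bounded_linear hT t0. Qed.

Lemma C0_sub t x y : 0 <= t -> T t (x - y) = T t x - T t y.
Proof.
move=> t0; pose L : {linear X -> X} := HB.pack (T t)
  (GRing.isLinear.Build _ _ _ _ (T t) (C0_linear t0)).
exact: (linearB L).
Qed.

Lemma C0_scale t a x : 0 <= t -> T t (a *: x) = a *: T t x.
Proof.
move=> t0; pose L : {linear X -> X} := HB.pack (T t)
  (GRing.isLinear.Build _ _ _ _ (T t) (C0_linear t0)).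
exact: (linearZ_LR L).
Qed.

Lemma C0_sum t n (f : nat -> X) : 0 <= t ->
  T t (\sum_(0 <= k < n) f k) = \sum_(0 <= k < n) T t (f k).
Proof.
move=> t0; pose L : {linear X -> X} := HB.pack (T t)
  (GRing.isLinear.Build _ _ _ _ (T t) (C0_linear t0)).
exact: (linear_sum L).
Qed.

Lemma C0_orbit_near0 x (e : R) : 0 < e ->
  exists2 d : R, 0 < d & forall t, 0 <= t <= d -> `|T t x - x| <= e.
Proof.
move=> e0; have /cvgrPdist_le/(_ e e0) := @C0_strong_continuous _ _ _ hT x.
rewrite near_withinE => -[d /= d0 hd]; exists (d / 2); first exact: divr_gt0.
move=> t /andP[]; rewrite le_eqVlt => /predU1P[<- _|t0 td].
  by rewrite (C0_0 hT) subrr normr0 ltW.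
rewrite distrC; apply: hd => //=; rewrite sub0r normrN gtr0_norm//.
by rewrite (le_lt_trans td)// gtr_pMr// invf_lt1// ltr1n.
Qed.

(** Otherwise there are times t_n -> 0+ with |T(t_n)| > n + 1; the operators
T(t_n) are pointwise bounded by strong continuity, which contradicts the
Banach-Steinhaus theorem. *)
Lemma C0_locally_bounded : exists d M : R, [/\ 0 < d, 0 < M &
  forall t x, 0 <= t <= d -> `|T t x| <= M * `|x|].
Proof.
apply: contrapT => H.
have {}H n : exists tx : R * X, 0 <= tx.1 <= n.+1%:R^-1 /\
    n.+1%:R * `|tx.2| < `|T tx.1 tx.2|.
  apply: contrapT => Hn; apply: H; exists n.+1%:R^-1, n.+1%:R.
  split; rewrite ?invr_gt0 ?ltr0n// => t x td.
  by rewrite leNgt; apply/negP => lt; apply: Hn; exists (t, x).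
have [tx Htx] := choice H.
pose F : set (X -> X) := [set T (tx n).1 | n in [set: nat]].
have t0 n : 0 <= (tx n).1 by have [/andP[]] := Htx n.
have Fbl f : F f -> bounded_fun_norm f /\ linear f.
  move=> [n _ <-]; have [lin [M hM]] := C0_bounded_linear hT (t0 n).
  split=> // r; exists (`|M| * r) => x xr; apply: le_trans (hM x) _.
  by rewrite (le_trans (ler_wpM2r _ (ler_norm M)))// ler_wpM2l.
have Fpt : pointwise_bounded F.
  move=> x; have [d d0 hd] := C0_orbit_near0 x ltr01.
  have [N _ hN] : \forall n \near \oo, n.+1%:R^-1 < d.
    exact: (near_infty_natSinv_lt (PosNum d0)).
  (* the sum bounds the finitely many times that are not yet within d of 0 *)
  exists (1 + `|x| + \sum_(0 <= k < N) `|T (tx k).1 x|) => _ [n _ <-].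
  have [nN|Nn] := ltnP n N.
    rewrite (bigD1_seq n)/= ?mem_index_iota ?iota_uniq//.
    rewrite [X in _ <= X]addrCA lerDl; apply: addr_ge0.
      exact: addr_ge0.
    by apply: sumr_ge0.
  rewrite ler_wpDr//; first by apply: sumr_ge0.
  rewrite -[T _ x](subrK x) (le_trans (ler_normD _ _))// lerD2r hd//.
  rewrite t0/=; have [/andP[_ tn] _] := Htx n.
  exact: le_trans tn (ltW (hN _ Nn)).
have [M hM] := Banach_Steinhauss Fbl Fpt 1.
pose n := Num.truncn `|M|.
have [_] := Htx n; apply/negP; rewrite -leNgt.
set x := (tx n).2; have [->|x0] := eqVneq x 0.
  by rewrite -(scale0r 0) C0_scale// !scale0r normr0 mulr0.
have nx : 0 < `|x| by rewrite normr_gt0.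
have := hM (T (tx n).1) (ex_intro2 _ _ n I erefl) (`|x|^-1 *: x).
rewrite normrZ normfV normr_id mulVf ?gt_eqF// => /(_ (lexx _)).
rewrite C0_scale// normrZ normfV normr_id ler_pdivrMl// => /le_trans; apply.
rewrite mulrC ler_wpM2r//; apply: le_trans (ler_norm M) _.
exact/ltW/truncnS_gt.
Qed.

End SemigroupBounded.

(** * Density of the domain of the generator *)

Section OrbitAverages.
Context {R : realType} {X : completeNormedModType R}.
Variable T : R -> X -> X.
Hypothesis hT : C0_semigroup T.

Definition orbit_sum (N : nat) (h : R) (x : X) : X :=
  \sum_(0 <= k < N) T (k%:R * h) x.

Definition orbit_avg (t : R) (x : X) (N : nat) : X :=
  N%:R^-1 *: orbit_sum N (t / N%:R) x.

Lemma orbit_sumD m N h x : 0 <= h ->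
  orbit_sum (m + N) h x = orbit_sum m h x + T (m%:R * h) (orbit_sum N h x).
Proof.
move=> h0; rewrite /orbit_sum (big_cat_nat (n := m))//= ?leq_addr//; congr (_ + _).
rewrite (C0_sum hT) ?mulr_ge0// -{1}[m]add0n big_addn addKn.
by apply: eq_bigr => k _; rewrite -(C0_add hT) ?mulr_ge0// -mulrDl natrD addrC.
Qed.

(** The identity (a^m - 1)(1 + ... + a^(N-1)) = (a^N - 1)(1 + ... + a^(m-1)) for
a = T(h): it compares the two ways of splitting a sum of m + N terms. *)
Lemma orbit_sum_swap m N h x : 0 <= h ->
  T (m%:R * h) (orbit_sum N h x) - orbit_sum N h x =
  T (N%:R * h) (orbit_sum m h x) - orbit_sum m h x.
Proof.
move=> h0; apply/eqP; rewrite subr_eq addrAC eq_sym subr_eq.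
by rewrite addrC -orbit_sumD// addnC orbit_sumD// addrC.
Qed.

Lemma orbit_sumM N K h x : 0 <= h ->
  orbit_sum (N * K) h x =
  \sum_(0 <= i < N) T (i%:R * (K%:R * h)) (orbit_sum K h x).
Proof.
move=> h0; elim: N => [|N IH]; first by rewrite mul0n /orbit_sum !big_geq.
by rewrite mulSn addnC orbit_sumD// IH big_nat_recr//= natrM mulrA.
Qed.

Lemma orbit_sum_near N h x e : 0 <= h ->
  (forall s, 0 <= s <= N%:R * h -> `|T s x - x| <= e) ->
  `|orbit_sum N h x - N%:R *: x| <= N%:R * e.
Proof.
move=> h0 he.
have -> : N%:R *: x = \sum_(0 <= k < N) x.
  by rewrite big_const_nat subn0 iter_addr addr0 scaler_nat.
rewrite -sumrB; apply: le_trans (ler_norm_sum _ _ _) _.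
have -> : N%:R * e = \sum_(0 <= k < N) e.
  by rewrite big_const_nat subn0 iter_addr addr0 mulr_natl.
rewrite big_nat_cond [leRHS]big_nat_cond; apply: ler_sum => k /andP[/andP[_ kN] _].
by apply: he; rewrite mulr_ge0//= ler_wpM2r// ler_nat ltnW.
Qed.

Variables (d M : R).
Hypothesis hM : forall t x, 0 <= t <= d -> `|T t x| <= M * `|x|.
Hypothesis M0 : 0 < M.

(** Splitting each of the N mesh intervals into K pieces replaces T(it/N)x by
T(it/N) applied to a mean of the orbit over [0, t/N], which is e-close to x. *)
Lemma orbit_avg_refine t x e N K : 0 <= t <= d -> (0 < N)%N -> (0 < K)%N ->
  (forall s, 0 <= s <= t / N%:R -> `|T s x - x| <= e) ->
  `|orbit_avg t x (N * K) - orbit_avg t x N| <= M * e.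
Proof.
move=> /andP[t0 td] N0 K0 he.
have N0' : 0 < N%:R :> R by rewrite ltr0n.
have K0' : 0 < K%:R :> R by rewrite ltr0n.
rewrite /orbit_avg orbit_sumM ?divr_ge0//.
set h := t / (N * K)%:R.
have h0 : 0 <= h by rewrite divr_ge0.
have hE : K%:R * h = t / N%:R.
  by rewrite /h natrM invfM mulrCA [_^-1 * _^-1]mulrC mulVKf ?gt_eqF.
have -> : (N * K)%:R^-1 *:
    (\sum_(0 <= i < N) T (i%:R * (K%:R * h)) (orbit_sum K h x)) =
    N%:R^-1 *: (\sum_(0 <= i < N) T (i%:R * (t / N%:R)) (K%:R^-1 *: orbit_sum K h x)).
  rewrite hE natrM invfM -scalerA; congr (_ *: _); rewrite scaler_sumr.
  by apply: eq_bigr => i _; rewrite (C0_scale hT)// mulr_ge0// divr_ge0.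
rewrite -scalerBr normrZ normfV gtr0_norm// ler_pdivrMl// /orbit_sum -sumrB.
apply: le_trans (ler_norm_sum _ _ _) _.
have -> : N%:R * (M * e) = \sum_(0 <= k < N) (M * e).
  by rewrite big_const_nat subn0 iter_addr addr0 mulr_natl.
rewrite big_nat_cond [leRHS]big_nat_cond; apply: ler_sum => k /andP[/andP[_ kN] _].
have k0 : 0 <= k%:R * (t / N%:R) by rewrite mulr_ge0// divr_ge0.
rewrite -(C0_sub hT)//; apply: le_trans (hM _ _) _.
  rewrite k0/= (le_trans _ td)// mulrCA ler_piMr// ler_pdivrMr// mul1r ler_nat.
  exact: ltnW.
apply: ler_wpM2l; first exact: ltW.
rewrite -(@ler_pM2l _ K%:R)//.
set v := (X in _ * `|X|).
have -> : K%:R * `|v| = `|K%:R *: v| by rewrite normrZ gtr0_norm.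
rewrite /v scalerBr scalerA mulfV ?gt_eqF// scale1r.
by apply: orbit_sum_near => //; rewrite hE.
Qed.

Lemma orbit_avg_cvg t x : 0 <= t <= d ->
  cvg (orbit_avg t x (2 ^ n)%N @[n --> \oo]).
Proof.
move=> td; apply/cauchy_cvgP/cauchy_exP => e e0.
have e1 : 0 < e / 2 / M by rewrite !divr_gt0.
have [c c0 hc] := C0_orbit_near0 hT x e1.
(* t may be 0, hence the denominator t + 1 *)
have t1 : 0 < c / (t + 1) by rewrite divr_gt0// ltr_wpDl//; case/andP: td.
have [n _ hn] := near_infty_natSinv_expn_lt (PosNum t1).
exists (orbit_avg t x (2 ^ n)%N); exists n => // m /= nm.
rewrite /= -ball_normE/= distrC -(subnKC nm) expnD.
apply: le_lt_trans (orbit_avg_refine (e := e / 2 / M) _ _ _ _) _ => //.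
- by rewrite expn_gt0.
- by rewrite expn_gt0.
- move=> s /andP[s0 st]; apply: hc; rewrite s0/= (le_trans st)//.
  have := hn _ (leqnn n); rewrite /= ltr_pdivlMr; last first.
    by rewrite ltr_wpDl//; case/andP: td.
  move=> /ltW; apply: le_trans; rewrite mulrC natrX div1r ler_wpM2l//.
  by rewrite lerDl.
by rewrite mulrC divfK ?gt_eqF// gtr_pMr// invf_lt1// ltr1n.
Qed.

Lemma orbit_avg_near t x e N : 0 <= t -> (0 < N)%N ->
  (forall s, 0 <= s <= t -> `|T s x - x| <= e) ->
  `|orbit_avg t x N - x| <= e.
Proof.
move=> t0 N0 he; have N0' : 0 < N%:R :> R by rewrite ltr0n.
have -> : orbit_avg t x N - x =
    N%:R^-1 *: (orbit_sum N (t / N%:R) x - N%:R *: x).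
  by rewrite scalerBr scalerA mulVf ?gt_eqF// scale1r.
rewrite normrZ normfV gtr0_norm// ler_pdivrMl//.
by apply: orbit_sum_near; rewrite ?divr_ge0// mulrC divfK ?gt_eqF.
Qed.

(** [orbit_sum_swap] turns the increment of the mean over m mesh steps into that
of an orbit sum with m terms over the time t, and this sum is within m e of m x. *)
Lemma orbit_avg_increment t x e N m : 0 < t <= d -> (0 < N)%N ->
  (forall s, 0 <= s <= m%:R * (t / N%:R) -> `|T s x - x| <= e) ->
  `|T (m%:R * (t / N%:R)) (orbit_avg t x N) - orbit_avg t x N
     - (m%:R / N%:R) *: (T t x - x)| <= m%:R / N%:R * ((M + 1) * e).
Proof.
move=> /andP[t0 td] N0 he; have N0' : 0 < N%:R :> R by rewrite ltr0n.
have t0' : 0 <= t by exact: ltW.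
have h0 : 0 <= t / N%:R by rewrite divr_ge0.
rewrite /orbit_avg (C0_scale hT) ?mulr_ge0//.
rewrite -scalerBr orbit_sum_swap//.
rewrite [N%:R * _]mulrC divfK ?gt_eqF// [m%:R / _]mulrC -scalerA.
rewrite -scalerBr.
rewrite normrZ normfV gtr0_norm// -mulrA ler_pM2l ?invr_gt0//.
set S := orbit_sum m _ x.
have -> : T t S - S - m%:R *: (T t x - x) = T t (S - m%:R *: x) - (S - m%:R *: x).
  by rewrite (C0_sub hT)// (C0_scale hT)// scalerBr !opprD !opprK addrACA.
have hS : `|S - m%:R *: x| <= m%:R * e by exact: orbit_sum_near.
apply: le_trans (ler_normB _ _) _.
rewrite mulrCA mulrDl mul1r; apply: lerD => //.
apply: le_trans (hM _ _) _; first by rewrite t0'.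
by rewrite ler_wpM2l// ltW.
Qed.

(** An arbitrary h is m t/N + r with 0 <= r < t/N.  The part m t/N is handled by
[orbit_avg_increment]; as N grows, the contributions of r and of replacing the
mean by its limit P tend to 0. *)
Lemma orbit_mean_increment t x P h e : 0 < t <= d -> 0 <= h <= d ->
  orbit_avg t x (2 ^ n)%N @[n --> \oo] --> P ->
  (forall s, 0 <= s <= h -> `|T s x - x| <= e) ->
  `|T h P - P - (h / t) *: (T t x - x)| <= h / t * (M * (M + 1) * e).
Proof.
move=> /andP[t0 td] /andP[h0 hd] cvgP he.
set D := T t x - x.
have ht0 : 0 <= h / t by rewrite divr_ge0// ltW.
have e0 : 0 <= e by apply: le_trans (he 0 _); rewrite ?lexx.
apply/ler_addgt0Pr => eta eta0.
(* the error terms below add up to c times this denominator at most *)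
pose c := eta / (2 * (M + 1) + 1 + h / t + `|D|).
have q0 : 0 < 2 * (M + 1) + 1 + h / t + `|D|.
  by rewrite ltr_wpDr// ltr_wpDr// ltr_wpDr// mulr_gt0// ltr_wpDr.
have c0 : 0 < c by rewrite divr_gt0.
have [c1 c10 hc1] := C0_orbit_near0 hT P c0.
have [c2 c20 hc2] := C0_orbit_near0 hT D c0.
have : \forall n \near \oo, [/\ `|P - orbit_avg t x (2 ^ n)| <= c,
    (2 ^ n)%:R^-1 <= c, t / (2 ^ n)%:R <= c1 & t / (2 ^ n)%:R <= c2].
  have small (b : R) : 0 < b -> \forall n \near \oo, (2 ^ n)%:R^-1 <= b.
    move=> b0; near=> n; apply/ltW; rewrite natrX -div1r; near: n.
    exact: (near_infty_natSinv_expn_lt (PosNum b0)).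
  near=> n; split; near: n.
  - by move/cvgrPdist_le : cvgP; exact.
  - exact: small.
  - near=> n; rewrite mulrC -ler_pdivlMr//; near: n; apply: small; exact: divr_gt0.
  - near=> n; rewrite mulrC -ler_pdivlMr//; near: n; apply: small; exact: divr_gt0.
move=> [n _ /(_ n (leqnn n))]; set N := (2 ^ n)%N => -[Pa Nc Nc1 Nc2].
have N0 : (0 < N)%N by rewrite expn_gt0.
have N0' : 0 < N%:R :> R by rewrite ltr0n.
set a := orbit_avg t x N in Pa.
set k := t / N%:R in Nc1 Nc2.
have k0 : 0 < k by rewrite divr_gt0.
pose m := Num.truncn (h / k).
have hk0 : 0 <= h / k by rewrite divr_ge0// ltW.
have /andP[mh hm] := truncn_itv hk0; rewrite -/m in mh hm.
pose r := h - m%:R * k.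
have r0 : 0 <= r by rewrite subr_ge0 -ler_pdivlMr.
have rk : r <= k.
  by rewrite lerBlDr -{1}[k]mul1r -mulrDl addrC natr1 -ler_pdivrMr// ltW.
have mk0 : 0 <= m%:R * k by rewrite mulr_ge0// ltW.
have mkh : m%:R * k <= h by rewrite -ler_pdivlMr.
have rh : r <= h by rewrite gerBl.
have hE : h = r + m%:R * k by rewrite subrK.
have mN : m%:R / N%:R = m%:R * k / t.
  by rewrite /k mulrA mulrAC mulfK ?gt_eqF.
have rd : 0 <= r <= d by rewrite r0 (le_trans rh).
have htE : h / t = m%:R / N%:R + r / t by rewrite mN -mulrDl addrC -hE.
have ThA : T h a = T r (T (m%:R * k) a) by rewrite {1}hE (C0_add hT).
(* telescoping: T h P is compared in turn with T h a, T r a + (m/N) D, T r P + (m/N) D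
   and P + (m/N) D *)
have dec : T h P - P - (h / t) *: D =
    T h (P - a) + (T r (T (m%:R * k) a - a - (m%:R / N%:R) *: D) +
      (m%:R / N%:R) *: (T r D - D)) + (T r (a - P) + (T r P - P)) - (r / t) *: D.
  (* D and a must be opaque for the linearity rewrites below *)
  clearbody D a; rewrite htE (C0_sub hT P a h0) (C0_sub hT a P r0) (C0_sub hT (T _ a - a) _ r0)
    (C0_sub hT (T _ a) a r0).
  rewrite (C0_scale hT _ D r0) ThA scalerDl scalerBr.
  rewrite opprD !addrA !subrK.
  move: (T h P) (T r a) ((_ / _) *: D) ((_ / _) *: D) => u1 u3 w3 w2.
  by rewrite [u1 - u3 - w2 + u3]addrAC subrK [u1 - P - w2]addrAC.
rewrite dec.
apply: (@le_trans _ _ (M * c + (h / t * (M * (M + 1) * e) + h / t * c) +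
    (M * c + c) + `|D| * c)).
  have M1 : 0 <= M + 1 by rewrite addr_ge0// ltW.
  have mNh : m%:R / N%:R <= h / t by rewrite mN ler_pM2r// invr_gt0.
  have rk' : 0 <= r <= k by rewrite r0.
  apply: le_trans (ler_normB _ _) _; apply: lerD.
    apply: le_trans (ler_normD _ _) _; apply: lerD.
      apply: le_trans (ler_normD _ _) _; apply: lerD.
        by apply: le_trans (hM _ _) _; rewrite ?h0// ler_wpM2l// ltW.
      apply: le_trans (ler_normD _ _) _; apply: lerD.
        apply: le_trans (hM _ rd) _.
        have -> : h / t * (M * (M + 1) * e) = M * (h / t * ((M + 1) * e)) by ring.
        rewrite ler_pM2l//.
        apply: le_trans (orbit_avg_increment (e := e) _ N0 _) _; rewrite ?t0//.
          by move=> s /andP[s0 sm]; apply: he; rewrite s0 (le_trans sm).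
        by rewrite ler_wpM2r// mulr_ge0.
      rewrite normrZ ger0_norm ?divr_ge0//; apply: ler_pM => //.
      by apply: hc2; rewrite r0 (le_trans rk).
    apply: le_trans (ler_normD _ _) _; apply: lerD.
      by apply: le_trans (hM _ rd) _; apply: ler_wpM2l; [exact: ltW|rewrite distrC].
    by apply: hc1; rewrite r0 (le_trans rk).
  have rt0 : 0 <= r / t by rewrite divr_ge0// ltW.
  rewrite normrZ (ger0_norm rt0) mulrC; apply: ler_wpM2l => //.
  by apply: le_trans Nc; rewrite ler_pdivrMr// mulrC.
have -> : eta = (2 * (M + 1) + 1 + h / t + `|D|) * c by rewrite mulrC divfK ?gt_eqF.
have -> : (2 * (M + 1) + 1 + h / t + `|D|) * c =
  (M * c + c + c) + (h / t * c + `|D| * c + (M * c + c)) by ring.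
have := ltW c0; lra.
Unshelve. all: by end_near. Qed.

End OrbitAverages.

(** The limit P of the means of the orbit over [0,t] satisfies
(T(h)P - P)/h -> (T(t)x - x)/t, and is as close to x as the orbit on [0,t]. *)
Lemma generator_domain_dense {R : realType} {X : completeNormedModType R}
    (DA : set X) (A : X -> X) (T : R -> X -> X) :
  C0_semigroup T -> generates DA A T ->
  forall x (e : R), 0 < e -> exists2 y, DA y & `|x - y| <= e.
Proof.
move=> hT hA x e e0.
have [d [M [d0 M0 hM]]] := C0_locally_bounded hT.
have [c c0 hc] := C0_orbit_near0 hT x e0.
pose t := Num.min d c.
have t0 : 0 < t by rewrite lt_min d0.
have td : 0 < t <= d by rewrite t0 ge_min lexx.
have td' : 0 <= t <= d by rewrite ltW//; case/andP: td.
have cvgP := orbit_avg_cvg hT hM M0 (x := x) td'.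
set P := lim _ in cvgP; exists P.
  apply/(generates_domain hA); exists (t^-1 *: (T t x - x)).
  apply/cvgrPdist_le => eta eta0.
  have MM0 : 0 < M * (M + 1) by rewrite mulr_gt0// addr_gt0.
  have e1 : 0 < eta * t / (M * (M + 1)) by apply: divr_gt0 => //; exact: mulr_gt0.
  have [b b0 hb] := C0_orbit_near0 hT x e1.
  near=> h.
  have h0 : 0 < h by near: h; exact: nbhs_right_gt.
  have hd : 0 <= h <= d.
    by rewrite (ltW h0)/=; near: h; exact: nbhs_right_le.
  have hb' : h <= b by near: h; exact: nbhs_right_le.
  have := orbit_mean_increment hT hM M0 td hd cvgP (e := eta * t / (M * (M + 1))).
  have -> : t^-1 *: (T t x - x) = h^-1 *: ((h / t) *: (T t x - x)).
    by rewrite scalerA mulKf ?gt_eqF.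
  rewrite distrC -scalerBr normrZ normfV gtr0_norm// ler_pdivrMl//.
  have -> : h / t * (M * (M + 1) * (eta * t / (M * (M + 1)))) = h * eta.
    by field; rewrite !gt_eqF// addr_gt0.
  apply=> s /andP[s0 sh]; apply: hb; rewrite s0; exact: le_trans sh hb'.
apply/ler_addgt0Pr => eta eta0.
move/cvgrPdist_le : (cvgP) => /(_ _ eta0)[n _ /(_ n (leqnn n))/= Pn].
rewrite -(subrK (orbit_avg T t x (2 ^ n)) x) -addrA.
apply: le_trans (ler_normD _ _) _; apply: lerD; last by rewrite distrC.
rewrite distrC; apply: orbit_avg_near; rewrite ?ltW ?expn_gt0// => s /andP[s0 st].
by apply: hc; rewrite s0 (le_trans st)// ge_min lexx orbT.
Unshelve. all: by end_near. Qed.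

(** * Differences of mild solutions *)

Section MildDifference.
Context {R : realType} {X U : completeNormedModType R} {UU : normedModType R}.
Variables (ev : UU -> R -> U) (T : R -> X -> X) (F : X -> U -> X).
Hypothesis hT : C0_semigroup T.

Lemma mild_solution_sub (x0 y0 : X) (u w : UU) (x y : R -> X) :
  {ae lebesgue_measure, forall s : R, 0 <= s ->
    F (x s - y s) (ev w s) = F (x s) (ev u s) - F (y s) (ev u s)} ->
  mild_solution ev T F x0 u x -> mild_solution ev T F y0 u y ->
  mild_solution ev T F (x0 - y0) w (fun t => x t - y t).
Proof.
move=> hF [cx ix] [cy iy]; split.
  by move=> t; apply: cvgB; [exact: cx|exact: cy].
move=> t t0; have [v bv ->] := ix t t0; have [v' bv' ->] := iy t t0.
exists (v - v'); last by rewrite C0_sub// opprD addrACA.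
apply: is_bochner_integral_sub bv bv' _.
apply: (@filterS _ _ (ae_lebesgue_filter R) _ _ _ hF) => s hs; rewrite in_itv/= => /andP[s0 st].
by rewrite hs// C0_sub// subr_ge0.
Qed.

Lemma input_zero_ae : input_space ev ->
  {ae lebesgue_measure, forall t : R, 0 <= t -> ev 0 t = 0}.
Proof.
move=> hUU; have := input_linear hUU (-1) 0 0.
apply: (@filterS _ _ (ae_lebesgue_filter R)) => t /[apply].
by rewrite scaler0 addr0 scaleN1r addNr.
Qed.

(** In the first case the forcing terms cancel and w = 0, whose representative
vanishes almost everywhere; in the second case w = u. *)
Lemma mild_solution_difference (x0 y0 : X) (u : UU) (x y : R -> X) :
  input_space ev ->
  (exists B : U -> X, bounded_linear B /\ forall xi v, F xi v = B v) \/
  (forall xi zeta v, F (xi - zeta) v = F xi v - F zeta v) ->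
  mild_solution ev T F x0 u x -> mild_solution ev T F y0 u y ->
  exists2 w : UU, `|w| <= `|u| &
    mild_solution ev T F (x0 - y0) w (fun t => x t - y t).
Proof.
move=> hUU [[B [[Blin _] FB]]|Fsub] mx my; last first.
  exists u => //; apply: mild_solution_sub mx my.
  by apply: aeW => s _; exact: Fsub.
exists 0; rewrite ?normr0//; apply: mild_solution_sub mx my.
have B0 : B 0 = 0 by have := Blin (-1) 0 0; rewrite scaler0 addr0 scaleN1r addNr.
apply: (@filterS _ _ (ae_lebesgue_filter R) _ _ _ (input_zero_ae hUU)) => s evs s0.
by rewrite !FB evs// B0 subrr.
Qed.

End MildDifference.

(** * Comparison functions and envelopes of decaying families *)

Section ComparisonFunctions.
Context {R : realType}.

Lemma class_K_le (f : R -> R) r s : class_K f -> 0 <= r -> r <= s -> f r <= f s.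
Proof.
move=> Kf r0; rewrite le_eqVlt => /predU1P[->//|rs].
exact/ltW/(class_K_increasing Kf).
Qed.

Lemma class_K_small (f : R -> R) e : class_K f -> 0 < e ->
  exists2 r, 0 < r & forall s, 0 <= s <= r -> f s <= e.
Proof.
move=> Kf e0; have := class_K_continuous Kf.
move=> /continuous_within_itvcyP[_ /cvgrPdist_le/(_ _ e0)].
rewrite near_withinE (class_K_0 Kf) => -[d /= d0 hd].
exists (d / 2); first exact: divr_gt0.
move=> s /andP[]; rewrite le_eqVlt => /predU1P[<- _|s0 sd].
  by rewrite (class_K_0 Kf) ltW.
have fs0 : 0 <= f s by apply: (class_K_ge0 Kf); exact: ltW.
rewrite -(ger0_norm fs0) -normrN -sub0r; apply: hd => //=.
rewrite sub0r normrN gtr0_norm// (le_lt_trans sd)//.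
by rewrite gtr_pMr// invf_lt1// ltr1n.
Qed.

Lemma class_Kinfty_add (f g : R -> R) :
  class_Kinfty f -> class_Kinfty g -> class_Kinfty (fun r => f r + g r).
Proof.
move=> [Kf fy] [Kg gy]; split; last first.
  move=> m; have [r r0 mf] := fy m; exists r => //.
  by rewrite ltr_wpDr// (class_K_ge0 Kg).
split.
- by move=> r r0; rewrite addr_ge0// ?(class_K_ge0 Kf)// (class_K_ge0 Kg).
- move=> r; apply: cvgD; [exact: (class_K_continuous Kf)|exact: (class_K_continuous Kg)].
- by move=> r s r0 rs; apply: ltrD; [exact: (class_K_increasing Kf)|exact: (class_K_increasing Kg)].
- by rewrite (class_K_0 Kf) (class_K_0 Kg) addr0.
Qed.

End ComparisonFunctions.

Section DecayEnvelope.
Context {R : realType}.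
Variables (E : set (R * R)) (C : R).
Hypothesis C0 : 0 <= C.
Hypothesis E_le : forall p, E p -> p.2 <= C.

Definition envelope_values (t : R) : set R :=
  [set z | z = 0 \/ exists2 p, E p & z = p.2 - Num.max 0 (t - p.1)].

(** The least function that is nonnegative, nonincreasing and 1-Lipschitz and has
value at least v at time s for every (s, v) in E.  It regularises the pointwise
supremum, which is in general neither continuous nor monotone. *)
Definition decay_envelope (t : R) : R := sup (envelope_values t).

Let envelope_values_le t z : envelope_values t z -> z <= C.
Proof.
move=> [->//|[p Ep ->]]; apply: le_trans (E_le Ep).
by rewrite gerBl le_max lexx.
Qed.

Let has_sup_envelope t : has_sup (envelope_values t).
Proof.
by split; [exists 0; left|exists C => z; exact: envelope_values_le].
Qed.

Let le_envelope t z : envelope_values t z -> z <= decay_envelope t.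
Proof. by move=> Az; apply: ub_le_sup Az; case: (has_sup_envelope t). Qed.

Let envelope_le t a : (forall z, envelope_values t z -> z <= a) -> decay_envelope t <= a.
Proof. by move=> h; apply: ge_sup => //; case: (has_sup_envelope t). Qed.

Lemma decay_envelope_ge0 t : 0 <= decay_envelope t.
Proof. by apply: le_envelope; left. Qed.

Lemma decay_envelope_le t : decay_envelope t <= C.
Proof. by apply: envelope_le => z; exact: envelope_values_le. Qed.

Lemma le_decay_envelope t v : E (t, v) -> v <= decay_envelope t.
Proof.
move=> Etv; apply: le_envelope; right; exists (t, v) => //=.
by rewrite subrr maxxx subr0.
Qed.

Lemma decay_envelope_nonincreasing s t : s <= t ->
  decay_envelope t <= decay_envelope s.
Proof.
move=> st; apply: envelope_le => _ [->|[p Ep ->]]; first exact: decay_envelope_ge0.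
apply: (@le_trans _ _ (p.2 - Num.max 0 (s - p.1))).
  by rewrite lerD2l lerN2 ge_max !le_max lexx/= lerD2r st orbT.
by apply: le_envelope; right; exists p.
Qed.

Lemma decay_envelope_lipschitz s t : s <= t ->
  decay_envelope s <= decay_envelope t + (t - s).
Proof.
move=> st; apply: envelope_le => _ [->|[p Ep ->]].
  by rewrite addr_ge0 ?subr_ge0// decay_envelope_ge0.
rewrite -lerBlDr; apply: (@le_trans _ _ (p.2 - Num.max 0 (t - p.1))).
  rewrite -addrA lerD2l -opprD lerN2 ge_max; apply/andP; split.
    by rewrite addr_ge0 ?subr_ge0// le_max lexx.
  rewrite [t - p.1](_ : _ = (s - p.1) + (t - s)); first by rewrite lerD2r le_max lexx orbT.
  by ring.
by apply: le_envelope; right; exists p.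
Qed.

Lemma decay_envelope_continuous : continuous decay_envelope.
Proof.
move=> t; apply/cvgrPdist_le => e e0.
near=> s; have : `|t - s| <= e.
  by near: s; by have /cvgrPdist_le/(_ e e0) := @cvg_id _ (nbhs t).
apply: le_trans.
have [st|/ltW ts] := leP s t.
  rewrite distrC !ger0_norm ?subr_ge0//; last exact: decay_envelope_nonincreasing.
  by rewrite lerBlDl decay_envelope_lipschitz.
rewrite [leRHS]distrC !ger0_norm ?subr_ge0//; last exact: decay_envelope_nonincreasing.
by rewrite lerBlDl decay_envelope_lipschitz.
Unshelve. all: by end_near. Qed.

Hypothesis E_decay : forall e, 0 < e ->
  exists tau, forall p, E p -> tau <= p.1 -> p.2 <= e.

(** Pairs (s, v) with s late have v <= e; those with s < tau have v <= C and
have lost all of it by the time C + tau. *)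
Lemma decay_envelope_cvg0 : decay_envelope t @[t --> +oo] --> 0.
Proof.
apply/cvgrPdist_le => e e0; have [tau htau] := E_decay e0.
near=> t; rewrite sub0r normrN ger0_norm ?decay_envelope_ge0//.
apply: envelope_le => _ [->|[p Ep ->]]; first exact: ltW.
have [ptau|taup] := leP tau p.1.
  by apply: le_trans (htau p Ep ptau); rewrite gerBl le_max lexx.
apply: le_trans (ltW e0); rewrite subr_le0 le_max; apply/orP; right.
apply: le_trans (E_le Ep) _; rewrite lerBrDr.
apply: (@le_trans _ _ (C + tau)); first by rewrite lerD2l ltW.
by near: t; apply: nbhs_pinfty_ge; exact: num_real.
Unshelve. all: by end_near. Qed.

Lemma class_L_decay_envelope : 0 < C ->
  class_L (fun t => decay_envelope t + C * expR (- t)).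
Proof.
move=> Cgt0; split.
- by move=> t t0; rewrite addr_ge0 ?decay_envelope_ge0// mulr_ge0// expR_ge0.
- apply: continuous_subspaceT => t; apply: cvgD.
    exact: decay_envelope_continuous.
  apply: cvgM; first exact: cvg_cst.
  apply: continuous_comp; [exact: opp_continuous|exact: continuous_expR].
- move=> s t s0 st; apply: ler_ltD; first exact/decay_envelope_nonincreasing/ltW.
  by rewrite ltr_pM2l// ltr_expR ltrN2.
- rewrite -[X in _ --> X]addr0 -[X in _ + X](mulr0 C); apply: cvgD.
    exact: decay_envelope_cvg0.
  apply: cvgM; first exact: cvg_cst.
  exact: cvgr_expR.
Qed.

End DecayEnvelope.

(** * From semi-uniform to strong input-to-state stability *)

(** Compare phi with the solution psi for the same input that starts at y0, and
bound the difference by uniform global stability. *)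
Lemma mild_solution_bound {R : realType} {X U : completeNormedModType R}
    {UU : normedModType R} (ev : UU -> R -> U) (DA : set X) (A : X -> X)
    (T : R -> X -> X) (F : X -> U -> X)
    (gamma mu mu' : R -> R) (kappa : R -> R -> R) :
  input_space ev -> C0_semigroup T ->
  (exists B : U -> X, bounded_linear B /\ forall xi v, F xi v = B v) \/
  (forall xi zeta v, F (xi - zeta) v = F xi v - F zeta v) ->
  forward_complete ev T F -> class_K mu ->
  (forall x0 u phi, mild_solution ev T F x0 u phi ->
    forall t, 0 <= t -> `|phi t| <= gamma `|x0| + mu `|u|) ->
  (forall x0 u phi, DA x0 -> mild_solution ev T F x0 u phi ->
    forall t, 0 <= t -> `|phi t| <= kappa (graph_norm A x0) t + mu' `|u|) ->
  forall x0 y0 u phi, DA y0 -> mild_solution ev T F x0 u phi ->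
  forall t, 0 <= t -> `|phi t| <=
    kappa (graph_norm A y0) t + gamma `|x0 - y0| + (mu `|u| + mu' `|u|).
Proof.
move=> hUU hT hF fc Kmu hUGS hISS x0 y0 u phi Dy0 mphi t t0.
have [psi mpsi _] := fc y0 u.
have [w wu mw] := mild_solution_difference hT hUU hF mphi mpsi.
have := hISS _ _ _ Dy0 mpsi t t0; have := hUGS _ _ _ mw t t0.
have : mu `|w| <= mu `|u| by exact: class_K_le.
have := ler_normD (phi t - psi t) (psi t); rewrite subrK.
lra.
Qed.

Theorem theorem3p11 (R : realType) (X U : completeNormedModType R)
    (UU : normedModType R) (ev : UU -> R -> U)
    (DA : set X) (A : X -> X) (T : R -> X -> X) (F : X -> U -> X)
    (hUU : input_space ev) (hT : C0_semigroup T) (hA : generates DA A T)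
    (hF : admissible_nonlinearity ev F)
    (hcond :
      (exists B : U -> X, bounded_linear B /\ forall xi v, F xi v = B v) \/
      (forall xi zeta v, F (xi - zeta) v = F xi v - F zeta v)) :
  semi_uniformly_ISS ev DA A T F -> strongly_ISS ev T F.
Proof.
move=> [[fc [gamma [mu [Kg Kmu hUGS]]]] [kappa [mu' [KLk Kmu' hISS]]]].
split=> //.
have gamma0 x : 0 <= gamma `|x| by apply: (class_K_ge0 Kg.1).
pose E x0 : set (R * R) := [set p | exists u phi,
  [/\ mild_solution ev T F x0 u phi, 0 <= p.1 &
      p.2 = `|phi p.1| - (mu `|u| + mu' `|u|)]].
have E_le x0 p : E x0 p -> p.2 <= gamma `|x0|.
  move=> [u [phi [mphi p0 ->]]]; have := hUGS _ _ _ mphi _ p0.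
  have := class_K_ge0 Kmu'.1 (normr_ge0 u); lra.
have E_decay x0 e : 0 < e -> exists tau, forall p, E x0 p -> tau <= p.1 -> p.2 <= e.
  move=> e0; have e2 : 0 < e / 2 by exact: divr_gt0.
  have [r r0 hr] := class_K_small Kg.1 e2.
  have [y0 Dy0 xy] := generator_domain_dense hT hA x0 r0.
  (* a itself may be 0, where kappa need not decrease strictly: use a + 1 *)
  pose a := graph_norm A y0; have a0 : 0 <= a by rewrite addr_ge0.
  have a1 : 0 < a + 1 by rewrite ltr_wpDl.
  have /cvgrPdist_le/(_ _ e2)[tau [_ htau]] := class_L_cvg0 (class_KL_L KLk a1).
  exists (tau + 1) => p [u [phi [mphi p0 ->]]] taup.
  have ltau : tau < p.1 by apply: lt_le_trans taup; rewrite ltrDl.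
  have := mild_solution_bound hUU hT hcond fc Kmu.1 hUGS hISS Dy0 mphi p0.
  rewrite -/a.
  have : kappa a p.1 <= kappa (a + 1) p.1.
    by apply: (class_K_le (class_KL_K KLk p0)) => //; rewrite lerDl.
  have : kappa (a + 1) p.1 <= e / 2.
    by have := htau _ ltau; rewrite sub0r normrN; apply: le_trans; exact: ler_norm.
  have : gamma `|x0 - y0| <= e / 2 by apply: hr; rewrite normr_ge0.
  lra.
exists (fun r => gamma r + gamma r), (fun r => mu r + mu' r),
  (fun x0 t => decay_envelope (E x0) t + gamma `|x0| * expR (- t)).
split; first by split; exact: class_Kinfty_add.
split.
- move=> x0 t t0; apply: addr_ge0.
    by apply: (@decay_envelope_ge0 _ _ (gamma `|x0|)) => // p; exact: E_le.
  by rewrite mulr_ge0// expR_ge0.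
- move=> x0 x00; apply: class_L_decay_envelope => //.
  + exact: E_le.
  + exact: E_decay.
  rewrite -(class_K_0 Kg.1); apply: (class_K_increasing Kg.1) => //.
  by rewrite normr_gt0.
- move=> x0 t t0; apply: lerD.
    by apply: decay_envelope_le => // p; exact: E_le.
  by rewrite ler_piMr// expR_le1 oppr_le0.
- move=> x0 u phi mphi t t0; rewrite -lerBlDr.
  apply: (@le_trans _ _ (decay_envelope (E x0) t)).
    apply: (@le_decay_envelope _ _ (gamma `|x0|)) => // [p|].
      exact: E_le.
    by exists u, phi.
  by rewrite lerDl mulr_ge0// expR_ge0.
Qed.
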